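(* Let $d \ge 3$ be a prime, and define polynomials $r_n, s_n \in \mathbb{Z}[b]$ by $r_0 = s_0 = 1$ and, for $n \ge 0$, \[ r_{n+1} = (b+1)\,d\, r_n s_n^{d-1}, \qquad s_{n+1} = r_n^d + (d-1) s_n^d. \] For $m \ge 1$ set $\sigma_m = (b+1)d\, s_{m-1}^d$, $\tau_m = s_m - \sigma_m$, and \[ \mathcal{G}_m = \frac{1}{bd}\left[(b+1)^d d^d s_{m-1}^{d(d-1)} - (bd+1)\,\frac{s_m^d - \bigl((b+1)d\, s_{m-1}^d\bigr)^d}{s_m - (b+1)d\, s_{m-1}^d}\right] \in \mathbb{Z}[b]. \] Let $D_k = \frac{d^k - 1}{d - 1}$. Then for every $m \ge 1$: (i) $N_d^-(\mathcal{G}_m) = L\bigl((0, d^m - 1), (d^m - d^{m-1} - 1, d^m - d^{m-1} - 1)\bigr)$; (ii) $N_d^-(\tau_m) = L\bigl((d^i + (m-1-i),\, d^i D_{m-i}) : i = 0, \dots, m-1\bigr) = L\bigl((m, D_m), (d + (m-2), d D_{m-1}), \dots, (d^{m-1}, d^{m-1})\bigr)$.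
   Context: For a prime $p$ and $f(z) = \sum_{i=0}^n a_i z^i \in \mathbb{Q}[z]$ with $a_n \ne 0$, write $v_i(f) = \mathrm{ord}_p(a_i)$ (with $\mathrm{ord}_p(0) = \infty$). The $p$-Newton polygon $N_p(f)$ is the lower convex hull of the points $(i, v_i(f))$, $0 \le i \le n$; its vertices are the points where the slope changes, together with the two endpoints. The principal $p$-Newton polygon $N_p^-(f)$ is the part of $N_p(f)$ consisting of the segments of negative slope (including slope $-\infty$). The notation $N_p^-(f) = L\bigl((i_1, v_{i_1}(f)), \dots, (i_k, v_{i_k}(f))\bigr)$ means that $i_1 = \min\{i : v_i(f) < \infty\}$ (the initial point is $(i_1, v_{i_1}(f))$), $i_1 < \cdots < i_k$, and these are exactly the vertices of $N_p^-(f)$ with finite coordinates. Here the polynomials are in the variable $b$ and $p = d$. *)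

(* Defs.v *)
From HB Require Import structures.
From mathcomp Require Import all_boot all_order all_algebra.
From mathcomp Require Import fraction constructive_ereal.

Set Implicit Arguments.
Unset Strict Implicit.
Unset Printing Implicit Defensive.

Import Order.TTheory GRing.Theory Num.Theory.
Local Open Scope ring_scope.

Definition ordp (p : nat) (a : rat) : \bar int :=
  if a == 0 then +oo%E
  else ((logn p `|numq a|)%:Z - (logn p `|denq a|)%:Z)%:E.

Definition vcoef (p : nat) (f : {poly rat}) (i : nat) : \bar int := ordp p f`_i.

(** Polygons are sets of points of the rational plane.  The breakpoints of a
    Newton polygon are lattice points, so nothing is lost by not passing to
    the real plane. *)
Definition point := (rat * rat)%type.

Definition barycenter (t : rat) (P Q : point) : point :=
  ((1 - t) * P.1 + t * Q.1, (1 - t) * P.2 + t * Q.2).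

Definition conv_hull (S : point -> Prop) (X : point) : Prop :=
  exists (n : nat) (w : 'I_n -> rat) (q : 'I_n -> point),
    [/\ forall i, 0 <= w i, \sum_i w i = 1, forall i, S (q i)
      & X = (\sum_i w i * (q i).1, \sum_i w i * (q i).2)].

Definition lower_hull (S : point -> Prop) (X : point) : Prop :=
  conv_hull S X /\ forall y, conv_hull S (X.1, y) -> X.2 <= y.

Definition slope (P Q : point) : rat := (Q.2 - P.2) / (Q.1 - P.1).

Definition is_segment (N : point -> Prop) (P Q : point) : Prop :=
  P.1 < Q.1 /\ forall t, 0 <= t <= 1 -> N (barycenter t P Q).

Definition left_end (N : point -> Prop) (X : point) : Prop :=
  N X /\ forall Y, N Y -> X.1 <= Y.1.

Definition right_end (N : point -> Prop) (X : point) : Prop :=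
  N X /\ forall Y, N Y -> Y.1 <= X.1.

Definition slope_changes (N : point -> Prop) (X : point) : Prop :=
  exists P Q, [/\ is_segment N P X, is_segment N X Q & slope P X <> slope X Q].

Definition vertex (N : point -> Prop) (X : point) : Prop :=
  [\/ left_end N X, right_end N X | slope_changes N X].

(** Only coefficients of finite valuation give a point at finite height; the
    points [(i, +oo)] do not affect the part of the hull at finite height. *)
Definition newton_point (p : nat) (f : {poly rat}) (X : point) : Prop :=
  exists (i : nat) (y : int), vcoef p f i = y%:E /\ X = (i%:R, y%:~R).

Definition newton_polygon (p : nat) (f : {poly rat}) : point -> Prop :=
  lower_hull (newton_point p f).

(** The segments of slope [-oo] join the points [(i, +oo)], for [i] smaller than
    the least index of a nonzero coefficient, to the left end of
    [newton_polygon p f], which is their only point at finite height. *)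
Definition principal_newton_polygon (p : nat) (f : {poly rat}) (X : point)
    : Prop :=
  left_end (newton_polygon p f) X \/
  exists P Q t, [/\ is_segment (newton_polygon p f) P Q, slope P Q < 0,
                    0 <= t <= 1 & X = barycenter t P Q].

(** [principal_newton_is p f l] stands for "N_p^-(f) = L(l)". *)
Definition principal_newton_is (p : nat) (f : {poly rat})
    (l : seq (nat * int)) : Prop :=
  [/\ (if l is (i1, _) :: _
       then vcoef p f i1 <> +oo%E /\ forall j, (j < i1)%N -> vcoef p f j = +oo%E
       else False),
      sorted ltn (map fst l),
      (forall P, P \in l -> vcoef p f P.1 = P.2%:E)
    & forall X : point, vertex (principal_newton_polygon p f) X <->
        X \in [seq (P.1%:R, P.2%:~R) | P <- l]].

Definition ZtoQ (f : {poly int}) : {poly rat} :=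
  map_poly (intr : int -> rat) f.

Fixpoint rs (d n : nat) : {poly int} * {poly int} :=
  if n is n'.+1 then
    let: (r, s) := rs d n' in
    (('X + 1) * d%:R * r * s ^+ (d - 1), r ^+ d + (d - 1)%:R * s ^+ d)
  else (1, 1).

Definition r_ (d n : nat) : {poly int} := (rs d n).1.
Definition s_ (d n : nat) : {poly int} := (rs d n).2.

Definition sigma (d m : nat) : {poly int} := ('X + 1) * d%:R * s_ d (m - 1) ^+ d.

Definition tau (d m : nat) : {poly int} := s_ d m - sigma d m.

(** The defining formula involves divisions, so it is read in the field Q(b) of
    fractions of Z[b]; that the result lies in Z[b] is left to be proved. *)
Definition calG (d m : nat) : {fraction {poly int}} :=
  (tofrac ('X * d%:R))^-1 *
  (tofrac (('X + 1) ^+ d * d%:R ^+ d * s_ d (m - 1) ^+ (d * (d - 1)))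
   - tofrac ('X * d%:R + 1) *
     (tofrac (s_ d m ^+ d - (('X + 1) * d%:R * s_ d (m - 1) ^+ d) ^+ d) /
      tofrac (s_ d m - ('X + 1) * d%:R * s_ d (m - 1) ^+ d))).

Definition D_ (d k : nat) : nat := ((d ^ k - 1) %/ (d - 1))%N.

(* Main.v *)
Require Import Defs.
From HB Require Import structures.
From mathcomp Require Import all_boot all_order all_algebra.
From mathcomp Require Import fraction constructive_ereal.
From mathcomp Require Import zify ring lra.

(** Since [s_m = sigma_m + tau_m] and [tau_(m+1) = r_m^d - (bd+1) s_m^d], one finds
    [tau_(m+1) = tau_m * B_m] with [B_m = b d G_m], so both polygons are read off
    from that of [B_m].  Expanding [((sigma + tau)^d - sigma^d) / tau] by the
    binomial theorem, [B_m + tau_m^(d-1)] has two kinds of terms: multiples of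
    [b d sigma_m^(d-1)] or of [b d tau_m^(d-1)], and terms carrying a binomial
    coefficient divisible by [d] and a factor [tau_m].  Let [a b^i] weigh
    [(d-1) ord_d(a) + i].
    By induction [tau_m] equals [+- (d b)^(d^(m-1))] up to terms of larger weight,
    hence [B_m] equals [- (d b)^E] with [E = (d-1) d^(m-1)] up to terms of larger
    weight.  Together with [d^E | B_m], [B_m(0) = 0] and a computation modulo
    [b^2] of the coefficient of [b], this gives the polygon of [B_m]: one edge
    of negative slope, from [(1, d^m)] to [(E, E)].  These slopes get less steep
    with [m], so the edges of the product [tau_m = - b d B_1 ... B_(m-1)] are
    those of its factors in order: for any slope between two consecutive ones,
    each factor has a single monomial of least weight, and so has [tau_m]. *)

Set Implicit Arguments.
Unset Strict Implicit.
Unset Printing Implicit Defensive.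

Import Order.TTheory GRing.Theory Num.Theory.
Local Open Scope ring_scope.

(** * Lower convex hulls and principal polygons *)

Lemma ratio_in01 (a b : rat) : 0 < b -> 0 <= a <= b -> 0 <= a / b <= 1.
Proof.
by move=> b0 /andP[a0 ab]; rewrite divr_ge0 ?(ltW b0) // ler_pdivrMr // mul1r.
Qed.

Section ConvexHull.

Variable S : point -> Prop.

Lemma conv_hull_point X : S X -> conv_hull S X.
Proof.
move=> SX; exists 1%N, (fun=> 1), (fun=> X); split => //.
  by rewrite big_ord1.
by rewrite !big_ord1 !mul1r; case: X {SX}.
Qed.

Lemma conv_hull_barycenter t P Q :
  0 <= t <= 1 -> conv_hull S P -> conv_hull S Q ->
  conv_hull S (barycenter t P Q).
Proof.
move=> /andP[t0 t1] [n [w [q [w0 w1 qS ->]]]] [n' [w' [q' [w0' w1' qS' ->]]]].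
exists (n + n')%N,
  (fun k => match split k with inl i => (1 - t) * w i | inr j => t * w' j end),
  (fun k => match split k with inl i => q i | inr j => q' j end).
have splitl (i : 'I_n) : split (lshift n' i) = inl i := unsplitK (inl i).
have splitr (j : 'I_n') : split (rshift n j) = inr j := unsplitK (inr j).
have sumE (F : 'I_n -> rat) (F' : 'I_n' -> rat) :
    \sum_(k < n + n') match split k with inl i => F i | inr j => F' j end
      = \sum_i F i + \sum_j F' j.
  rewrite big_split_ord /=; congr (_ + _); apply: eq_bigr => i _.
    by rewrite splitl.
  by rewrite splitr.
have coordE (c : point -> rat) :
    \sum_(k < n + n') match split k with
        inl i => (1 - t) * w i | inr j => t * w' j end *
      c (match split k with inl i => q i | inr j => q' j end) =
    (1 - t) * \sum_i w i * c (q i) + t * \sum_j w' j * c (q' j).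
  rewrite !mulr_sumr -sumE; apply: eq_bigr => k _.
  by case: (split k) => i; rewrite mulrA.
split.
- by move=> k; case: (split k) => i; rewrite mulr_ge0 // subr_ge0.
- by rewrite sumE -!mulr_sumr w1 w1'; ring.
- by move=> k; case: (split k).
- by rewrite (coordE fst) (coordE snd).
Qed.

(** A weighted mean of numbers that are at least [c] is at least [c]. All lower bounds on the
    polygon come from supporting lines in this way. *)
Lemma conv_hull_half_plane (a b c : rat) X :
  (forall Y, S Y -> c <= a * Y.1 + b * Y.2) ->
  conv_hull S X -> c <= a * X.1 + b * X.2.
Proof.
move=> Sc [n [w [q [w0 w1 qS ->]]]] /=.
rewrite -[c]mul1r -w1 mulr_suml !mulr_sumr -big_split /=.
apply: ler_sum => i _.
have := ler_wpM2l (w0 i) (Sc _ (qS i)).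
by rewrite mulrDr; lra.
Qed.

(** A lower hull is the graph of a function of the abscissa; points of the polygon are identified
    through this fact. *)
Lemma lower_hull_inj X Y :
  lower_hull S X -> lower_hull S Y -> X.1 = Y.1 -> X = Y.
Proof.
case: X Y => [x y] [x' y'] [/= cX mX] [/= cY mY] xE; subst x'.
by congr pair; apply: le_anti; rewrite mX ?mY.
Qed.

End ConvexHull.

(** * Recognizing a principal polygon from its vertices *)

Section PrincipalPolygon.

Variables (p : nat) (f : {poly rat}) (m : nat) (n v : nat -> nat).

Hypothesis n_incr : forall i, (i < m)%N -> (n i < n i.+1)%N.
Hypothesis v_decr : forall i, (i < m)%N -> (v i.+1 < v i)%N.
Hypothesis convex : forall i, (i.+1 < m)%N ->
  ((v i.+1 - v i.+2) * (n i.+1 - n i) < (v i - v i.+1) * (n i.+2 - n i.+1))%N.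
Hypothesis on_polygon : forall i, (i <= m)%N -> vcoef p f (n i) = (Posz (v i))%:E.
Hypothesis left_zero : forall j, (j < n 0)%N -> vcoef p f j = +oo%E.
(** If edge [i] has width [W] and drop [H], then [W y + H j] is constant along its line; clearing
    denominators keeps the condition in the integers. *)
Hypothesis above_edge : forall i j (y : int), (i < m)%N -> vcoef p f j = y%:E ->
  (n i.+1 - n i)%:Z * (v i)%:Z + (v i - v i.+1)%:Z * (n i)%:Z <=
  (n i.+1 - n i)%:Z * y + (v i - v i.+1)%:Z * j%:Z.
Hypothesis above_last : forall j (y : int), vcoef p f j = y%:E -> (v m)%:Z <= y.

Let S := newton_point p f.
Let N := newton_polygon p f.
Let M := principal_newton_polygon p f.
Let V i : point := ((n i)%:R, (v i)%:R).
Let w i : rat := (n i.+1)%:R - (n i)%:R.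
Let h i : rat := (v i)%:R - (v i.+1)%:R.

Let w_gt0 i : (i < m)%N -> 0 < w i.
Proof. by move=> im; rewrite subr_gt0 ltr_nat n_incr. Qed.

Let h_gt0 i : (i < m)%N -> 0 < h i.
Proof. by move=> im; rewrite subr_gt0 ltr_nat v_decr. Qed.

Let convexR i : (i.+1 < m)%N -> h i.+1 * w i < h i * w i.+1.
Proof.
move=> im; have im' := ltnW im.
have := convex im.
by rewrite -(ltr_nat rat) !natrM !natrB // ltnW // ?n_incr ?v_decr.
Qed.

Let V_in_S i : (i <= m)%N -> S (V i).
Proof. by move=> im; exists (n i), (Posz (v i)); rewrite on_polygon. Qed.

Let hull_edge i X : (i < m)%N -> conv_hull S X ->
  h i * (n i)%:R + w i * (v i)%:R <= h i * X.1 + w i * X.2.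
Proof.
move=> im; apply: conv_hull_half_plane => Y [j [y [jy ->]]] /=.
have := above_edge im jy; rewrite -(ler_int rat) !intrD !intrM -!pmulrn.
rewrite !natrB 1?ltnW ?n_incr ?v_decr // /w /h; lra.
Qed.

Let hull_left X : conv_hull S X -> (n 0)%:R <= X.1.
Proof.
move=> cX; suff : (n 0)%:R <= 1 * X.1 + 0 * X.2 by rewrite mul1r mul0r addr0.
apply: conv_hull_half_plane cX => Y [j [y [jy ->]]] /=.
rewrite mul1r mul0r addr0 ler_nat leqNgt; apply/negP => /left_zero.
by rewrite jy.
Qed.

Let hull_last X : conv_hull S X -> (v m)%:R <= X.2.
Proof.
move=> cX; suff : (v m)%:R <= 0 * X.1 + 1 * X.2 by rewrite mul1r mul0r add0r.
apply: conv_hull_half_plane cX => Y [j [y [jy ->]]] /=.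
by rewrite mul1r mul0r add0r -[_%:R]/((Posz (v m))%:~R) ler_int (above_last jy).
Qed.

(** The line through the edge bounds the hull from below, so a point of the chord, which is in the
    hull, is lowest on its vertical. *)
Let N_edge i t : (i < m)%N -> 0 <= t <= 1 -> N (barycenter t (V i) (V i.+1)).
Proof.
move=> im t01; split.
  by apply: conv_hull_barycenter => //; apply: conv_hull_point; apply: V_in_S;
    rewrite // ltnW.
move=> y /(hull_edge im) /= ge_edge.
rewrite -(ler_pM2l (w_gt0 im)); move: ge_edge; rewrite /w /h; lra.
Qed.

Let N_V i : (i <= m)%N -> N (V i).
Proof.
have bary0 P Q : barycenter 0 P Q = P.
  by rewrite /barycenter subr0 !mul1r !mul0r !addr0; case: P.
have bary1 P Q : barycenter 1 P Q = Q.
  by rewrite /barycenter subrr !mul1r !mul0r !add0r; case: Q.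
case: i => [_|i im]; last by rewrite -(bary1 (V i) (V i.+1)); apply: N_edge => //; lra.
(* Without edges, minimality at the only vertex comes from the bound on heights. *)
case: (posnP m) => [m0|m0].
  split; first exact/conv_hull_point/V_in_S.
  by move=> y /hull_last /=; rewrite m0.
by rewrite -(bary0 (V 0) (V 1)); apply: N_edge => //; lra.
Qed.

Let on_edge i X : (i < m)%N -> N X -> (n i)%:R <= X.1 <= (n i.+1)%:R ->
  X = barycenter ((X.1 - (n i)%:R) / w i) (V i) (V i.+1).
Proof.
move=> im NX /andP[lX uX].
have w0 := w_gt0 im.
have wu : w i != 0 by rewrite gt_eqF.
apply: lower_hull_inj NX _ _; first apply: N_edge => //.
  by apply: ratio_in01 => //; rewrite subr_ge0 lX lerD2r.
by rewrite /= /w in wu *; field.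
Qed.

Let edge_line i X : (i < m)%N -> N X -> (n i)%:R <= X.1 <= (n i.+1)%:R ->
  w i * X.2 = w i * (v i)%:R - h i * (X.1 - (n i)%:R).
Proof.
move=> im NX hX; rewrite {1}(on_edge im NX hX) /= /h.
by have := w_gt0 im; rewrite /w => w0; field; rewrite gt_eqF.
Qed.

Let nW i j : (i <= j)%N -> (j <= m)%N -> (n i <= n j)%N.
Proof.
elim: j => [|j IH]; first by rewrite leqn0 => /eqP->.
rewrite leq_eqVlt => /predU1P[-> //|ij] jm.
by apply: leq_trans (IH ij (ltnW jm)) _; apply/ltnW/n_incr.
Qed.

Let find_edge (x : rat) : (0 < m)%N -> (n 0)%:R <= x <= (n m)%:R ->
  exists2 i, (i < m)%N & (n i)%:R <= x <= (n i.+1)%:R.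
Proof.
move=> m0 /andP[x0].
suff find k : (0 < k)%N -> (k <= m)%N -> x <= (n k)%:R ->
    exists2 i, (i < m)%N & (n i)%:R <= x <= (n i.+1)%:R by exact: find.
elim: k => // k IH _ km xk.
case: (lerP (n k)%:R x) => [kx|/ltW xk']; first by exists k; rewrite ?kx ?xk.
case: (posnP k) => [k0|k0]; first by exists k; rewrite // xk k0 x0.
exact: IH k0 (ltnW km) xk'.
Qed.

Let V_slope i : (i < m)%N -> slope (V i) (V i.+1) = - h i / w i.
Proof. by move=> im; rewrite /slope /= /h /w opprB. Qed.

Let edge_segment i : (i < m)%N -> is_segment N (V i) (V i.+1).
Proof. by move=> im; split=> [|t]; [rewrite ltr_nat n_incr | apply: N_edge]. Qed.

(* A segment of negative slope cannot pass the last vertex: beyond it the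
   polygon stays above the height [v m]. *)
Let M_N X : M X <-> N X /\ X.1 <= (n m)%:R.
Proof.
split=> [[[NX minX]|[P [Q [t [[PQ segPQ] sPQ t01 ->]]]]]|[NX Xm]].
- by split=> //; apply: (minX (V m)); apply: N_V.
- split; first exact: segPQ.
  have NP : N P.
    by have := segPQ 0; rewrite /barycenter subr0 !mul1r !mul0r !addr0;
      case: (P) => ? ? /=; apply; lra.
  have NQ : N Q.
    by have := segPQ 1; rewrite /barycenter subrr !mul1r !mul0r !add0r;
      case: (Q) => ? ? /=; apply; lra.
  have PQ' : 0 < Q.1 - P.1 by rewrite subr_gt0.
  have hPQ : Q.2 < P.2.
    by move: sPQ; rewrite /slope pmulr_llt0 ?invr_gt0 // subr_lt0.
  have Qm : Q.1 <= (n m)%:R.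
    rewrite leNgt; apply/negP => Qm.
    have Q2 : (v m)%:R <= Q.2 := hull_last (proj1 NQ).
    (* If [P] is not left of [V m], the chord from [V m] to [Q] passes at or above [P], at height at
       most [Q.2], against [Q.2 < P.2]. *)
    case: (lerP (n m)%:R P.1) => Pm.
      pose u := (P.1 - (n m)%:R) / (Q.1 - (n m)%:R).
      have Qm0 : Q.1 - (n m)%:R != 0 by rewrite subr_eq0 gt_eqF.
      have u01 : 0 <= u <= 1.
        by apply: ratio_in01; lra.
      have := conv_hull_barycenter u01 (conv_hull_point (V_in_S (leqnn m)))
        (proj1 NQ).
      rewrite /barycenter /=.
      have -> : (1 - u) * (n m)%:R + u * Q.1 = P.1 by rewrite /u; field.
      move/(proj2 NP) => /=; nra.
    (* Otherwise the segment passes through [V m]; descending strictly from there to [Q], it would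
       end below the height [v m]. *)
    pose u := ((n m)%:R - P.1) / (Q.1 - P.1).
    have u0 : 0 < u by rewrite divr_gt0 ?subr_gt0.
    have u01 : 0 <= u <= 1.
      by apply: ratio_in01; lra.
    have /lower_hull_inj/(_ (N_V (leqnn m))) := segPQ _ u01.
    rewrite /barycenter /=.
    have -> : (1 - u) * P.1 + u * Q.1 = (n m)%:R.
      by rewrite /u; field; rewrite gt_eqF.
    have u1 : u < 1 by rewrite ltr_pdivrMr ?mul1r; lra.
    by move=> /(_ erefl) [] /=; nra.
  rewrite /barycenter /=; nra.
case: (ltrP (n 0)%:R X.1) => [X0|X0]; last first.
  left; split=> // Y NY; apply: le_trans X0 _; exact: hull_left (proj1 NY).
right.
have m0 : (0 < m)%N.
  by rewrite lt0n; apply/eqP => m0; move: Xm X0; rewrite m0; lra.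
have [|i im iX] := find_edge m0 (x := X.1); first by rewrite Xm ltW.
exists (V i), (V i.+1), ((X.1 - (n i)%:R) / w i); split.
- exact: edge_segment.
- by rewrite V_slope // mulNr oppr_lt0 divr_gt0 ?h_gt0 ?w_gt0.
- by apply: ratio_in01; rewrite ?w_gt0 // subr_ge0 lerD2r.
- exact: on_edge.
Qed.

Let M_V i : (i <= m)%N -> M (V i).
Proof. by move=> im; apply/M_N; split; [apply: N_V | rewrite ler_nat nW]. Qed.

Let M_edge_segment i : (i < m)%N -> is_segment M (V i) (V i.+1).
Proof.
move=> im; have [lt seg] := edge_segment im; split=> // t t01.
apply/M_N; split; first exact: seg.
have : (n i.+1)%:R <= (n m)%:R :> rat by rewrite ler_nat nW.
move: lt; rewrite /barycenter /V /=; case/andP: t01 => t0 t1.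
move: (n i)%:R (n i.+1)%:R (n m)%:R => a b c.
by nra.
Qed.

Let segment_ends P Q : is_segment M P Q -> M P /\ M Q.
Proof.
move=> [_ seg]; split.
  have := seg 0; rewrite lexx ler01 => /(_ isT).
  by rewrite /barycenter subr0 !mul1r !mul0r !addr0; case: (P).
have := seg 1; rewrite lexx ler01 => /(_ isT).
by rewrite /barycenter subrr !mul1r !mul0r !add0r; case: (Q).
Qed.

Let segment_at P Q x : is_segment M P Q -> P.1 <= x <= Q.1 ->
  N (x, P.2 + (x - P.1) * slope P Q).
Proof.
move=> [PQ seg] /andP[Px xQ].
have PQ0 : 0 < Q.1 - P.1 by rewrite subr_gt0.
have t01 : 0 <= (x - P.1) / (Q.1 - P.1) <= 1.
  by apply: ratio_in01 => //; rewrite subr_ge0 Px lerD2r.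
have [+ _] := iffLR (M_N _) (seg _ t01); congr N.
by congr pair => /=; rewrite /slope; field; rewrite gt_eqF.
Qed.

Let slope_left i P X : (i < m)%N -> is_segment M P X ->
  (n i)%:R < X.1 <= (n i.+1)%:R -> slope P X = - h i / w i.
Proof.
move=> im seg /andP[iX Xi]; have [_ /M_N[NX _]] := segment_ends seg.
have PX := proj1 seg.
have w0 := w_gt0 im.
have wu : w i != 0 by rewrite gt_eqF.
(* Between [x] and [X.1] the segment runs along edge [i]; the heights at these two abscissas
   determine its slope. *)
pose x := Num.max P.1 (n i)%:R.
have Px : P.1 <= x <= X.1 by rewrite le_max lexx ge_max (ltW PX) (ltW iX).
have xi : (n i)%:R <= x <= (n i.+1)%:R.
  rewrite le_max lexx orbT ge_max (le_trans (ltW PX) Xi) /=.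
  exact: le_trans (ltW iX) Xi.
have := edge_line im (segment_at seg Px) xi.
have := edge_line im NX; rewrite ltW //= => /(_ Xi).
have xX : x < X.1 by rewrite gt_max PX iX.
have -> : X.2 = P.2 + (X.1 - P.1) * slope P X.
  by rewrite /slope; field; rewrite subr_eq0 gt_eqF.
move: (slope P X) => s e1 e2.
have : w i * ((X.1 - x) * s) = - h i * (X.1 - x).
  have -> : (X.1 - x) * s = P.2 + (X.1 - P.1) * s - (P.2 + (x - P.1) * s) by ring.
  by rewrite mulrBr e1 e2; ring.
rewrite mulrCA mulrC => /(mulIf _) <-; last by rewrite subr_eq0 gt_eqF.
by field.
Qed.

Let slope_right i X Q : (i < m)%N -> is_segment M X Q ->
  (n i)%:R <= X.1 < (n i.+1)%:R -> slope X Q = - h i / w i.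
Proof.
move=> im seg /andP[iX Xi]; have [/M_N[NX _] _] := segment_ends seg.
have XQ := proj1 seg.
have w0 := w_gt0 im.
have wu : w i != 0 by rewrite gt_eqF.
pose x := Num.min Q.1 (n i.+1)%:R.
have Px : X.1 <= x <= Q.1 by rewrite ge_min lexx le_min (ltW XQ) (ltW Xi).
have xi : (n i)%:R <= x <= (n i.+1)%:R.
  rewrite ge_min lexx orbT le_min (le_trans iX (ltW XQ)) andbT /=.
  exact: le_trans iX (ltW Xi).
have := edge_line im (segment_at seg Px) xi.
have := edge_line im NX; rewrite iX ltW //= => /(_ isT).
have xX : X.1 < x by rewrite lt_min XQ Xi.
move: (slope X Q) => s e1 e2.
have : w i * ((x - X.1) * s) = - h i * (x - X.1).
  have -> : (x - X.1) * s = X.2 + (x - X.1) * s - X.2 by ring.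
  by rewrite mulrBr e1 e2; ring.
rewrite mulrCA mulrC => /(mulIf _) <-; last by rewrite subr_eq0 gt_eqF.
by field.
Qed.

Let vertexP X : vertex M X <-> exists2 i, (i <= m)%N & X = V i.
Proof.
split=> [[[/M_N[NX _] minX]|[/M_N[NX Xm] maxX]|[P [Q [PX XQ]]]]|[i im ->]].
- exists 0%N => //; apply: lower_hull_inj (NX) (N_V _) _ => //.
  apply/le_anti/andP; split; last exact: hull_left (proj1 NX).
  exact: minX (M_V (leq0n m)).
- exists m => //; apply: lower_hull_inj (NX) (N_V _) _ => //.
  by apply/le_anti/andP; split=> //; exact: maxX (M_V (leqnn m)).
- move=> neq; have [/M_N[NP _] /M_N[NX Xm]] := segment_ends PX.
  have X0 : (n 0)%:R < X.1.
    exact: le_lt_trans (hull_left (proj1 NP)) (proj1 PX).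
  have m0 : (0 < m)%N.
    by rewrite lt0n; apply/eqP => m0; move: Xm X0; rewrite m0; lra.
  have [|i im /andP[iX Xi]] := find_edge m0 (x := X.1); first by rewrite Xm ltW.
  have eqV j : (j <= m)%N -> X.1 = (n j)%:R -> exists2 i, (i <= m)%N & X = V i.
    by move=> jm e; exists j => //; apply: lower_hull_inj NX (N_V jm) e.
  move: iX; rewrite le_eqVlt => /predU1P[/esym/eqV|iX]; first by apply; exact: ltnW.
  move: Xi; rewrite le_eqVlt => /predU1P[/eqV|Xi]; first by apply.
  (* Now [X] is strictly inside edge [i], so the segments on both of its sides have the slope of
     that edge. *)
  case: neq; rewrite (slope_left im PX) ?iX ?(ltW Xi) //.
  by rewrite (slope_right im XQ) // Xi ltW.
- case: (posnP i) => [->|i0].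
    by constructor 1; split; [exact: M_V | move=> Y /M_N[[/hull_left]]].
  move: im; rewrite leq_eqVlt => /predU1P[->|im].
    by constructor 2; split; [exact: M_V | move=> Y /M_N[]].
  case: i i0 im => // i _ im.
  constructor 3; exists (V i), (V i.+2); split; try exact: M_edge_segment.
    by apply: M_edge_segment; exact: ltnW.
  rewrite !V_slope ?(ltnW im) // !mulNr => /oppr_inj/eqP.
  by rewrite eqr_div ?gt_eqF ?w_gt0 ?convexR // ltnW.
Qed.

Lemma principal_newton_isP :
  principal_newton_is p f [seq (n i, Posz (v i)) | i <- iota 0 m.+1].
Proof.
split.
- by split; [rewrite on_polygon | apply: left_zero].
- have -> : [seq P.1 | P <- [seq (n i, Posz (v i)) | i <- iota 0 m.+1]] =
            [seq n i | i <- iota 0 m.+1] by rewrite -map_comp.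
  apply/(sortedP 0%N) => i; rewrite size_map size_iota => im.
  have im' := ltnW im.
  by rewrite !(nth_map 0%N) ?size_iota // !nth_iota // !add0n; apply: n_incr.
- by move=> P /mapP[i]; rewrite mem_iota => /= im ->; apply: on_polygon.
- move=> X; rewrite vertexP -map_comp; split=> [[i im ->]|/mapP[i]].
    by apply/mapP; exists i; rewrite ?mem_iota.
  by rewrite mem_iota => /= im ->; exists i.
Qed.

End PrincipalPolygon.

(** * Weighted divisibility of integer polynomials *)

Section Weights.

Variable d : nat.

(** This is [ord_d a = k] in terms of divisibility; zero satisfies it for no [k]. *)
Definition exactly (k : nat) (a : int) :=
  (d%:Z ^+ k %| a)%Z && ~~ (d%:Z ^+ k.+1 %| a)%Z.

(* [weighs w h c f] bounds from below by [c] the weight [w * ord_d a + h * i] of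
   every monomial [a b^i] of [f]: the Newton polygon of [f] lies above a line of
   slope [- h / w]. *)
Definition mono_weighs (w h c i : nat) (a : int) :=
  exists2 k, (d%:Z ^+ k %| a)%Z & (c <= w * k + h * i)%N.

Definition weighs (w h c : nat) (f : {poly int}) :=
  forall i, mono_weighs w h c i f`_i.

(** The line of slope [- h / w] through [(n, k)] touches the Newton polygon of [f] at that point
    only: one monomial is strictly lightest. *)
Definition dominates (w h n k : nat) (f : {poly int}) :=
  exactly k f`_n /\
  forall i, i != n -> mono_weighs w h (w * k + h * n).+1 i f`_i.

Section FixedWeight.

Variables w h : nat.
Hypothesis w_gt0 : (0 < w)%N.

Lemma mono_weighs0 c i : mono_weighs w h c i 0.
Proof. by exists c; [exact: dvdz0 | nia]. Qed.

Lemma mono_weighsD c i a a' :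
  mono_weighs w h c i a -> mono_weighs w h c i a' -> mono_weighs w h c i (a + a').
Proof.
move=> [k ka ck] [k' ka' ck']; exists (minn k k'); last by rewrite /minn; case: ifP.
by apply: rpredD; [apply: dvdz_trans ka | apply: dvdz_trans ka'];
  apply: dvdz_exp2l; rewrite ?geq_minl ?geq_minr.
Qed.

Lemma mono_weighsN c i a : mono_weighs w h c i a -> mono_weighs w h c i (- a).
Proof. by move=> [k ka ck]; exists k => //; rewrite rpredN. Qed.

Lemma mono_weighsM c c' i j a a' :
  mono_weighs w h c i a -> mono_weighs w h c' j a' ->
  mono_weighs w h (c + c') (i + j) (a * a').
Proof.
move=> [k ka ck] [k' ka' ck']; exists (k + k')%N.
  by rewrite exprD dvdz_mul.
by rewrite !mulnDr addnACA leq_add.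
Qed.

Lemma mono_weighsW c c' i a :
  (c <= c')%N -> mono_weighs w h c' i a -> mono_weighs w h c i a.
Proof. by move=> cc' [k ka ck]; exists k => //; exact: leq_trans ck. Qed.

Lemma mono_weighs_sum c i (I : Type) (r : seq I) (P : pred I) (F : I -> int) :
  (forall j, P j -> mono_weighs w h c i (F j)) ->
  mono_weighs w h c i (\sum_(j <- r | P j) F j).
Proof.
move=> FP; apply: (big_ind (mono_weighs w h c i)) => //.
  exact: mono_weighs0.
by move=> *; apply: mono_weighsD.
Qed.

Lemma mono_weighs_exactly c i k a :
  exactly k a -> (w * k + h * i >= c)%N -> mono_weighs w h c i a.
Proof. by case/andP=> ka _ ck; exists k. Qed.

Lemma weighs_any f : weighs w h 0 f.
Proof. by move=> i; exists 0%N; rewrite ?expr0 ?dvd1z. Qed.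

Lemma weighs0 c : weighs w h c 0.
Proof. by move=> i; rewrite coef0; apply: mono_weighs0. Qed.

Lemma weighsD c f g : weighs w h c f -> weighs w h c g -> weighs w h c (f + g).
Proof. by move=> cf cg i; rewrite coefD; apply: mono_weighsD. Qed.

Lemma weighsN c f : weighs w h c f -> weighs w h c (- f).
Proof. by move=> cf i; rewrite coefN; apply: mono_weighsN. Qed.

Lemma weighsB c f g : weighs w h c f -> weighs w h c g -> weighs w h c (f - g).
Proof. by move=> cf /weighsN; apply: weighsD. Qed.

Lemma weighsW c c' f : (c <= c')%N -> weighs w h c' f -> weighs w h c f.
Proof. by move=> cc' cf i; apply: mono_weighsW (cf i). Qed.

Lemma weighsM c c' f g :
  weighs w h c f -> weighs w h c' g -> weighs w h (c + c') (f * g).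
Proof.
move=> cf cg i; rewrite coefM; apply: mono_weighs_sum => j _.
have ji : (j <= i)%N by rewrite -ltnS.
by have := mono_weighsM (cf j) (cg (i - j)%N); rewrite subnKC.
Qed.

Lemma weighsMl c f g : weighs w h c g -> weighs w h c (f * g).
Proof. by move=> cg; have := weighsM (weighs_any f) cg; rewrite add0n. Qed.

Lemma weighsX c k f : weighs w h c f -> weighs w h (c * k) (f ^+ k).
Proof.
move=> cf; elim: k => [|k IH]; first by rewrite muln0; apply: weighs_any.
by rewrite mulnS exprS; apply: weighsM.
Qed.

Lemma weighs_sum c (I : Type) (r : seq I) (P : pred I) (F : I -> {poly int}) :
  (forall j, P j -> weighs w h c (F j)) ->
  weighs w h c (\sum_(j <- r | P j) F j).
Proof.
move=> FP; apply: (big_ind (weighs w h c)) => //; first exact: weighs0.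
by move=> *; apply: weighsD.
Qed.

(** Through this gain of [w], binomial coefficients divisible by [d] make terms negligible. *)
Lemma weighsMn c f N : (d %| N)%N -> weighs w h c f -> weighs w h (w + c) (f *+ N).
Proof.
move=> dN cf i; have [k kf ck] := cf i; exists k.+1; last by nia.
rewrite coefMn -mulr_natl exprS dvdz_mul //.
by rewrite natz dvdzE.
Qed.

Lemma weighs_d : weighs w h w d%:R.
Proof. by have := weighsMn (dvdnn d) (weighs_any 1); rewrite addn0. Qed.

Lemma weighs_X : weighs w h h 'X.
Proof.
move=> i; rewrite coefX; case: eqP => [->|_]; last exact: mono_weighs0.
by exists 0%N; rewrite ?expr0 ?dvd1z ?muln0 ?muln1.
Qed.

Lemma dominates_weighs n k f : dominates w h n k f -> weighs w h (w * k + h * n) f.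
Proof.
move=> [kf ltf] i; case: (eqVneq i n) => [->|/ltf]; last exact: mono_weighsW.
exact: mono_weighs_exactly kf _.
Qed.

End FixedWeight.

Lemma weighs_congr w h c x y :
  weighs w h c y -> weighs w h c.+1 (x - y) -> weighs w h c x.
Proof.
by move=> yw xyw; rewrite -(subrK y x); apply: weighsD => //; apply: weighsW xyw.
Qed.

(** Telescoping: each term of [x ^ k - y ^ k] has one factor [x - y], which is heavier by one. So
    leading parts are compatible with powers. *)
Lemma weighs_expr_congr w h c x y k : (0 < w)%N ->
  weighs w h c y -> weighs w h c.+1 (x - y) ->
  weighs w h (c * k).+1 (x ^+ k - y ^+ k).
Proof.
move=> w0 yw xyw; have xw := weighs_congr yw xyw.
elim: k => [|k IH]; first by rewrite !expr0 subrr; apply: weighs0.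
have -> : x ^+ k.+1 - y ^+ k.+1 = (x - y) * x ^+ k + y * (x ^+ k - y ^+ k).
  by rewrite !exprS; ring.
rewrite mulnS; apply: weighsD => //.
  by rewrite -addSn; apply: weighsM => //; apply: weighsX.
by rewrite -addnS; apply: weighsM.
Qed.

(** * Exact valuations, and the passage from weights to Newton polygons *)

Hypothesis d_prime : prime d.

Lemma exactlyP k a :
  reflect (exists2 u, ~~ (d%:Z %| u)%Z & a = u * d%:Z ^+ k) (exactly k a).
Proof.
have dk0 : d%:Z ^+ k != 0 by rewrite expf_neq0 // gt_eqF // ltz_nat prime_gt0.
apply: (iffP andP) => [[/dvdzP[u ->]]|[u du ->]].
  by rewrite exprS dvdz_mul2r // => du; exists u.
by rewrite dvdz_mull // exprS dvdz_mul2r.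
Qed.

Lemma prime_dvdzM (a b : int) : (d%:Z %| a * b)%Z = (d%:Z %| a)%Z || (d%:Z %| b)%Z.
Proof. by rewrite !dvdzE abszM /= Euclid_dvdM. Qed.

Lemma exactlyM k k' a a' :
  exactly k a -> exactly k' a' -> exactly (k + k') (a * a').
Proof.
move=> /exactlyP[u du ->] /exactlyP[u' du' ->]; apply/exactlyP.
exists (u * u'); last by rewrite exprD mulrACA.
by rewrite prime_dvdzM negb_or du.
Qed.

Lemma exactlyD k a b : exactly k a -> (d%:Z ^+ k.+1 %| b)%Z -> exactly k (a + b).
Proof.
move=> /andP[ka nka] kb; rewrite /exactly rpredD //=; last first.
  by apply: dvdz_trans kb; apply: dvdz_exp2l.
by apply: contra nka => kab; rewrite -(addrK b a) rpredB.
Qed.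

Lemma exactlyN k a : exactly k (- a) = exactly k a.
Proof. by rewrite /exactly !rpredN. Qed.

(** Only the product of the two lightest monomials reaches the least total weight, so nothing
    cancels it; primality makes its valuation the sum [k + k']. *)
Lemma dominatesM w h n n' k k' f g : (0 < w)%N ->
  dominates w h n k f -> dominates w h n' k' g ->
  dominates w h (n + n') (k + k') (f * g).
Proof.
move=> w_gt0 domf domg.
have := dominates_weighs domf; have := dominates_weighs domg.
move: domf domg => [kf ltf] [kg ltg] weg wef.
pose c := (w * (k + k') + h * (n + n'))%N.
have strict i j : (i != n) || (j != n') ->
    mono_weighs w h c.+1 (i + j) (f`_i * g`_j).
  case/orP=> [/ltf ltfi|/ltg ltgj].
    by apply: mono_weighsW (mono_weighsM ltfi (weg j)); rewrite /c; nia.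
  by apply: mono_weighsW (mono_weighsM (wef i) ltgj); rewrite /c; nia.
split=> [|N NE]; rewrite coefM.
  rewrite (bigD1 (inord n)) //= inordK ?ltnS ?leq_addr //.
  rewrite addKn; apply: exactlyD; first exact: exactlyM.
  have [K KN cK] : mono_weighs w h c.+1 (n + n')
      (\sum_(i < (n + n').+1 | i != inord n) f`_i * g`_(n + n' - i)).
    apply: mono_weighs_sum => // i ni.
    have iN : (i <= n + n')%N by rewrite -ltnS.
    rewrite -{1}(subnKC iN); apply: strict; apply/orP; left.
    apply: contra ni => /eqP iE; rewrite -val_eqE /= inordK ?iE //.
    by rewrite ltnS leq_addr.
  (* At the fixed degree [n + n'], a larger weight means a larger power of [d]. *)
  by apply: dvdz_trans KN; apply: dvdz_exp2l; move: cK; rewrite /c; nia.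
apply: mono_weighs_sum => // i _.
have iN : (i <= N)%N by rewrite -ltnS.
rewrite -{1}(subnKC iN); apply: strict; rewrite -negb_and.
by apply: contra NE => /andP[/eqP <- /eqP <-]; rewrite subnKC.
Qed.

Lemma vcoef_ZtoQ (F : {poly int}) i : vcoef d (ZtoQ F) i =
  if F`_i == 0 then +oo%E else (Posz (logn d `|F`_i|))%:E.
Proof.
rewrite /vcoef /ordp coef_map /= intr_eq0; case: eqP => // _.
by rewrite numq_int denq_int logn1 subr0.
Qed.

Lemma vcoef_exactly (F : {poly int}) i k :
  exactly k F`_i -> vcoef d (ZtoQ F) i = (Posz k)%:E.
Proof.
rewrite vcoef_ZtoQ => /exactlyP[u du ->].
have u0 : u != 0 by apply: contraNneq du => ->; rewrite dvdz0.
have dgt0 := prime_gt0 d_prime.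
have dk0 : d%:Z ^+ k != 0 by rewrite expf_neq0 // gt_eqF // ltz_nat.
rewrite mulf_eq0 (negPf u0) (negPf dk0) /=.
rewrite abszM abszX lognM ?absz_gt0 ?expn_gt0 /= ?dgt0 // pfactorK //.
by rewrite lognE d_prime absz_gt0 u0 -[(d %| `|u|)%N]/(d%:Z %| u)%Z (negPf du).
Qed.

Lemma vcoef_ge (F : {poly int}) i k (y : int) :
  vcoef d (ZtoQ F) i = y%:E -> (d%:Z ^+ k %| F`_i)%Z -> k%:Z <= y.
Proof.
rewrite vcoef_ZtoQ; case: eqP => // /eqP Fi0 [<-].
by rewrite dvdzE abszX /= pfactor_dvdn // absz_gt0.
Qed.

Lemma weighs_vcoef w h c (F : {poly int}) i (y : int) :
  weighs w h c F -> vcoef d (ZtoQ F) i = y%:E -> c%:Z <= w%:Z * y + h%:Z * i%:Z.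
Proof.
move=> /(_ i)[k ki ck] vi; have := vcoef_ge vi ki; nia.
Qed.

(** Each edge gives a weight bound with its own width and drop. The weight [(1, 0)] counts powers of
    [d] alone and bounds the heights by that of the last vertex. *)
Lemma principal_newton_is_weighs (F : {poly int}) (m : nat) (n v : nat -> nat) :
  (forall i, (i < m)%N -> (n i < n i.+1)%N) ->
  (forall i, (i < m)%N -> (v i.+1 < v i)%N) ->
  (forall i, (i.+1 < m)%N ->
     ((v i.+1 - v i.+2) * (n i.+1 - n i) < (v i - v i.+1) * (n i.+2 - n i.+1))%N) ->
  (forall i, (i <= m)%N -> exactly (v i) F`_(n i)) ->
  (forall j, (j < n 0)%N -> F`_j = 0) ->
  (forall i, (i < m)%N -> weighs (n i.+1 - n i) (v i - v i.+1)
     ((n i.+1 - n i) * v i + (v i - v i.+1) * n i) F) ->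
  weighs 1 0 (v m) F ->
  principal_newton_is d (ZtoQ F) [seq (n i, Posz (v i)) | i <- iota 0 m.+1].
Proof.
move=> n_incr v_decr convex exact left0 edge last.
apply: principal_newton_isP => //.
- by move=> i /exact/vcoef_exactly.
- by move=> j /left0 Fj; rewrite vcoef_ZtoQ Fj eqxx.
- by move=> i j y /edge we vj; have := weighs_vcoef we vj; lia.
- by move=> j y vj; have := weighs_vcoef last vj; lia.
Qed.

End Weights.

(** * The recurrence for [tau] *)

(* The quotient [((x + y) ^+ d - x ^+ d) / y], expanded in powers of [y]. *)
Definition diff_quotient (R : comNzRingType) (d : nat) (x y : R) : R :=
  \sum_(k < d) y ^+ k * x ^+ (d - k.+1) *+ 'C(d, k.+1).

(** The terms with coefficients ['C(d, 2)] to ['C(d, d - 1)], all divisible by [d] when [d] is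
    prime, after removal of one factor [y]. *)
Definition diff_quotient_mid (R : comNzRingType) (d : nat) (x y : R) : R :=
  \sum_(k < d - 2) y ^+ k * x ^+ (d - k.+2) *+ 'C(d, k.+2).

Lemma diff_quotientE (R : comNzRingType) (d : nat) (x y : R) :
  y * diff_quotient d x y = (x + y) ^+ d - x ^+ d.
Proof.
rewrite exprDn big_ord_recl /= subn0 mulr1 bin0 mulr1n addrC addKr mulr_sumr.
apply: eq_bigr => k _; rewrite /bump leq0n add1n.
by rewrite mulrnAr mulrA -exprS mulrC.
Qed.

Lemma diff_quotient_split (R : comNzRingType) (d : nat) (x y : R) :
  (2 <= d)%N -> diff_quotient d x y =
  x ^+ d.-1 *+ d + y * diff_quotient_mid d x y + y ^+ d.-1.
Proof.
case: d => [|[|d]] // _.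
rewrite /diff_quotient big_ord_recl big_ord_recr /= expr0 mul1r bin1 subn1 /=.
rewrite /bump leq0n add1n binn mulr1n subnn mulr1 -[RHS]addrA.
set a := x ^+ _ *+ _; congr (a + (_ + _)); rewrite {}/a.
rewrite /diff_quotient_mid !subSS subn0 mulr_sumr; apply: eq_bigr => k _.
by rewrite /bump leq0n add1n !subSS mulrnAr mulrA -exprS.
Qed.

Lemma D_S d k : (2 <= d)%N -> D_ d k.+1 = (D_ d k + d ^ k)%N.
Proof.
move=> d2; rewrite /D_ expnS.
have d1 : (0 < d - 1)%N by lia.
have dk : (0 < d ^ k)%N by rewrite expn_gt0; lia.
have -> : (d * d ^ k - 1 = d ^ k - 1 + d ^ k * (d - 1))%N by nia.
by rewrite divnDMl.
Qed.

(** To the right of [(1, q)], a line through that point at least as steep as the edge of slope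
    [- x / W] stays below the edge. *)
Lemma left_vertex_le (W x w h q k i : nat) : (0 < W)%N -> (0 < i)%N ->
  (W * q + x <= W * k + x * i)%N -> (x * w <= h * W)%N ->
  (w * q + h <= w * k + h * i)%N.
Proof.
move=> W0; case: i => // i _ edge wh.
case: (leqP q k) => [qk|kq]; first by nia.
have [t qE] : exists t, q = (k + t)%N by exists (q - k)%N; lia.
suff : (w * t <= h * i)%N by nia.
rewrite -(leq_pmul2l W0) (leq_trans (_ : _ <= x * w * i)%N) //; nia.
Qed.

Lemma left_vertex_lt (W x w h q k i : nat) : (0 < W)%N -> (1 < i)%N ->
  (W * q + x <= W * k + x * i)%N -> (x * w < h * W)%N ->
  (w * q + h < w * k + h * i)%N.
Proof.
move=> W0; case: i => // i; rewrite ltnS => i0 edge wh.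
have h0 : (0 < h)%N by case: (posnP h) wh => // ->.
case: (leqP q k) => [qk|kq]; first by nia.
have [t qE] : exists t, q = (k + t)%N by exists (q - k)%N; lia.
suff : (w * t < h * i)%N by nia.
rewrite -(ltn_pmul2l W0) (leq_ltn_trans (_ : _ <= x * w * i)%N) //; nia.
Qed.

(** Mirror image at the right end [(E, E)]: a line at most as steep as the edge stays below it on
    the left, and [E <= k] handles the points on the right. *)
Lemma right_vertex_le (W x w h E k i : nat) : (0 < W)%N -> (E <= k)%N ->
  (W * E + x * E <= W * k + x * i)%N -> (h * W <= x * w)%N ->
  (w * E + h * E <= w * k + h * i)%N.
Proof.
move=> W0 Ek edge wh; case: (leqP E i) => [Ei|iE]; first by nia.
have [t kE] : exists t, k = (E + t)%N by exists (k - E)%N; lia.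
have [u EE] : exists u, E = (i + u)%N by exists (E - i)%N; lia.
suff : (h * u <= w * t)%N by nia.
rewrite -(leq_pmul2l W0) (leq_trans (_ : _ <= x * w * u)%N) //; nia.
Qed.

Lemma right_vertex_lt (W x w h E k i : nat) : (0 < W)%N -> (0 < h)%N -> (E <= k)%N ->
  i != E -> (W * E + x * E <= W * k + x * i)%N -> (h * W < x * w)%N ->
  (w * E + h * E < w * k + h * i)%N.
Proof.
move=> W0 h0 Ek niE edge wh; case: (ltngtP E i) => [Ei|iE|iE]; first by nia.
  have [t kE] : exists t, k = (E + t)%N by exists (k - E)%N; lia.
  have [u EE] : exists u, E = (i + u)%N by exists (E - i)%N; lia.
  suff : (h * u < w * t)%N by nia.
  rewrite -(ltn_pmul2l W0) (@leq_trans (x * w * u)%N) //; nia.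
by rewrite iE eqxx in niE.
Qed.

Section Recurrence.

Variable d : nat.
Hypothesis d_prime : prime d.
Hypothesis d_ge3 : (3 <= d)%N.

Let d_gt0 : (0 < d)%N. Proof. by lia. Qed.
Let d1_gt0 : (0 < d - 1)%N. Proof. by lia. Qed.

Lemma d_odd : odd d.
Proof. by case: (even_prime d_prime) => // d2; move: d_ge3; rewrite d2. Qed.

(* [step n] is [b d G_(n+1)]. *)
Definition step (n : nat) : {poly int} :=
  ('X + 1) * d%:R * sigma d n.+1 ^+ d.-1
  - ('X * d%:R + 1) * diff_quotient d (sigma d n.+1) (tau d n.+1).

Lemma s_S n : s_ d n.+1 = r_ d n ^+ d + (d - 1)%:R * s_ d n ^+ d.
Proof. by rewrite /s_ /r_ /=; case: (rs d n). Qed.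

Lemma r_S n : r_ d n.+1 = ('X + 1) * d%:R * r_ d n * s_ d n ^+ (d - 1).
Proof. by rewrite /s_ /r_ /=; case: (rs d n). Qed.

Lemma sigmaS n : sigma d n.+1 = ('X + 1) * d%:R * s_ d n ^+ d.
Proof. by rewrite /sigma subn1. Qed.

Lemma s_sigma_tau n : s_ d n.+1 = sigma d n.+1 + tau d n.+1.
Proof. by rewrite /tau addrC subrK. Qed.

Lemma tau_r n : tau d n.+1 = r_ d n ^+ d - ('X * d%:R + 1) * s_ d n ^+ d.
Proof. by rewrite /tau sigmaS s_S natrB //; ring. Qed.

Lemma sigma_expr n : sigma d n.+1 ^+ d.-1 * (('X + 1) * d%:R) =
  ('X + 1) ^+ d * d%:R ^+ d * s_ d n ^+ (d * (d - 1)).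
Proof.
by rewrite sigmaS exprMn -exprM mulrAC -exprSr prednK // exprMn subn1.
Qed.

Lemma tau1 : tau d 1 = - ('X * d%:R).
Proof. by rewrite tau_r /r_ /s_ /= !expr1n; ring. Qed.

(** Substituting [r_n^d = tau + (bd+1) s_n^d] into [r_(n+1)^d] produces a term [(bd+1) sigma^d],
    which turns [(bd+1) s_(n+1)^d] into [(bd+1) (s_(n+1)^d - sigma^d)], a multiple of [tau]. *)
Lemma tau_S n : tau d n.+2 = tau d n.+1 * step n.
Proof.
rewrite tau_r mulrBr [_ * (_ * diff_quotient _ _ _)]mulrCA diff_quotientE.
rewrite -s_sigma_tau.
have -> : r_ d n.+1 ^+ d = sigma d n.+1 ^+ d.-1 * (('X + 1) * d%:R) * r_ d n ^+ d.
  rewrite sigma_expr r_S exprMn [(_ * r_ d n) ^+ d]exprMn exprMn -exprM mulnC.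
  by rewrite mulrAC.
have rE : r_ d n ^+ d = tau d n.+1 + ('X * d%:R + 1) * s_ d n ^+ d.
  by rewrite tau_r subrK.
have sE : sigma d n.+1 ^+ d = sigma d n.+1 ^+ d.-1 * (('X + 1) * d%:R * s_ d n ^+ d).
  by rewrite -sigmaS -exprSr prednK.
by rewrite rE sE; ring.
Qed.

(** The two contributions to [sigma^(d-1)] combine by [(b+1) d - (bd+1) d = - b d (d-1)], which
    gains a factor [b]. *)
Lemma stepE n : step n =
  - ('X * sigma d n.+1 ^+ d.-1 *+ d *+ (d - 1))
  - ('X * d%:R + 1) * (tau d n.+1 * diff_quotient_mid d (sigma d n.+1) (tau d n.+1)
                       + tau d n.+1 ^+ d.-1).
Proof.
rewrite /step diff_quotient_split; last by lia.
have mulrnE (x : {poly int}) N : x *+ N = x * N%:R by rewrite mulr_natr.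
rewrite (mulrnE (sigma _ _ ^+ _)) (mulrnE (_ *+ d)) (mulrnE ('X * _)) natrB //.
by ring.
Qed.

(** * Contents and leading forms of [sigma], [tau] and [step] *)

Lemma sigma_weighs_content n : weighs d 1 0 (d ^ n) (sigma d n.+1) /\
                               weighs d 1 0 (d ^ n) (tau d n.+1).
Proof.
elim: n => [|n [IHs IHt]].
  rewrite expn0 tau1 sigmaS /s_ /= expr1n mulr1.
  have w1 : weighs d 1 0 1 d%:R by exact: weighs_d.
  by split; [|apply: weighsN]; apply: weighsMl.
have dE : (d ^ n.+1 = d ^ n + d ^ n * d.-1)%N by rewrite -mulnS prednK // expnSr.
split.
  rewrite sigmaS -mulrA; apply: weighsMl => //; apply: weighsMl => //.
  rewrite expnSr; apply: weighsX => //.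
  by rewrite s_sigma_tau; apply: weighsD.
(* Both parts of [step n] are multiples of forms of degree [d - 1] in [sigma] and [tau], each of
   which is divisible by [d ^ (d ^ n)]. *)
rewrite tau_S dE; apply: weighsM => //.
apply: weighsB => //.
  by apply: weighsMl => //; apply: weighsX.
apply: weighsMl => //; apply: weighs_sum => // k _.
rewrite -mulr_natl; apply: weighsMl => //.
have -> : (d ^ n * d.-1 = d ^ n * k + d ^ n * (d - k.+1))%N.
  by rewrite -mulnDr; congr (_ * _)%N; have := ltn_ord k; lia.
by apply: weighsM => //; apply: weighsX.
Qed.

Lemma step_weighs_content n : weighs d 1 0 ((d - 1) * d ^ n) (step n).
Proof.
have [sw tw] := sigma_weighs_content n.
apply: weighsB => //.
  by apply: weighsMl => //; rewrite mulnC subn1; apply: weighsX.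
apply: weighsMl => //; apply: weighs_sum => // k _.
rewrite -mulr_natl; apply: weighsMl => //.
have -> : ((d - 1) * d ^ n = d ^ n * k + d ^ n * (d - k.+1))%N.
  by rewrite -mulnDr mulnC; congr (_ * _)%N; have := ltn_ord k; lia.
by apply: weighsM => //; apply: weighsX.
Qed.

(* In the weight where [b ^ (d - 1)] weighs as much as [d], the middle binomial
   terms of [step n] are negligible and [tau ^ (d - 1)] is its leading part. *)
Lemma step_leading_tau n :
  weighs d (d - 1) 1 (d ^ n.+1 - 1) (sigma d n.+1) ->
  weighs d (d - 1) 1 (d ^ n.+1) (tau d n.+1) ->
  weighs d (d - 1) 1 ((d - 1) * d ^ n.+1 + 1) (step n + tau d n.+1 ^+ d.-1).
Proof.
move=> sw tw; set q := (d ^ n.+1)%N in sw tw *.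
have q0 : (0 < q)%N by rewrite expn_gt0 d_gt0.
set c := ((d - 1) * q + 1)%N.
have Xd : weighs d (d - 1) 1 (1 + (d - 1)) ('X * d%:R).
  by apply: weighsM => //; [exact: weighs_X | exact: weighs_d].
have tX : weighs d (d - 1) 1 (q * d.-1) (tau d n.+1 ^+ d.-1) by apply: weighsX.
(* Each factor [sigma] may be one unit lighter than [tau]. At most [d - 2] of them occur, and the
   binomial coefficient adds [d - 1]. *)
have mid : weighs d (d - 1) 1 c
    (tau d n.+1 * diff_quotient_mid d (sigma d n.+1) (tau d n.+1)).
  rewrite mulr_sumr; apply: weighs_sum => // k _.
  rewrite mulrnAr; have kd := ltn_ord k.
  have dC : (d %| 'C(d, k.+2))%N by apply: prime_dvd_bin => //; lia.
  apply: weighsW (weighsMn _ dC (weighsM _ tw (weighsM _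
    (weighsX _ k tw) (weighsX _ (d - k.+2) sw)))) => //.
  have -> : (d - k.+2 = d - 2 - k)%N by lia.
  by rewrite /c; nia.
have -> : step n + tau d n.+1 ^+ d.-1 =
  - ('X * sigma d n.+1 ^+ d.-1 *+ d *+ (d - 1))
  - (('X * d%:R + 1) * (tau d n.+1 * diff_quotient_mid d (sigma d n.+1) (tau d n.+1))
     + 'X * d%:R * tau d n.+1 ^+ d.-1) by rewrite stepE; ring.
apply: weighsB => //; last apply: weighsD => //.
- apply: weighsN => //; rewrite -mulr_natl; apply: weighsMl => //.
  (* Here [d - 1] factors [sigma] lose [d - 1] units, while [d] and [b] add [d]. *)
  have -> : c = (d - 1 + (1 + (q - 1) * d.-1))%N by rewrite /c; nia.
  apply: weighsMn => //; apply: weighsM => //; first exact: weighs_X.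
  exact: weighsX.
- exact: weighsMl.
- apply: weighsW (weighsM _ Xd tX) => //; rewrite /c; nia.
Qed.

Let weighs_dX N : weighs d (d - 1) 1 (d * N) ((d%:R * 'X) ^+ N).
Proof.
apply: weighsX => //; rewrite -[X in weighs d _ _ X](subnK d_gt0).
by apply: weighsM => //; [exact: weighs_d | exact: weighs_X].
Qed.

Let weighs_sign_dX e N :
  weighs d (d - 1) 1 (d * N) ((-1) ^+ e * (d%:R * 'X) ^+ N).
Proof. by apply: weighsMl => //; exact: weighs_dX. Qed.

(** Since [step n] is [- tau^(d-1)] up to heavier terms, the next [tau] is [- tau^d]. As [d] is odd,
    the sign flips once at every stage. *)
Lemma tau_leading n :
  weighs d (d - 1) 1 (d ^ n.+1 - 1) (sigma d n.+1) /\
  weighs d (d - 1) 1 (d ^ n.+1).+1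
    (tau d n.+1 - (-1) ^+ n.+1 * (d%:R * 'X) ^+ (d ^ n)).
Proof.
elim: n => [|n [IHs IHt]].
  rewrite tau1 sigmaS /s_ /= expr1n mulr1 expn0 !expr1 expn1; split.
    by apply: weighsMl => //; exact: weighs_d.
  have -> : - ('X * d%:R) - -1 * (d%:R * 'X) = 0 :> {poly int} by ring.
  exact: weighs0.
have Tw := weighs_sign_dX n.+1 (d ^ n); rewrite -expnS in Tw.
have tw : weighs d (d - 1) 1 (d ^ n.+1) (tau d n.+1).
  exact: weighs_congr Tw IHt.
have q0 : (0 < d ^ n.+1)%N by rewrite expn_gt0 d_gt0.
split.
  rewrite sigmaS -mulrA; apply: weighsMl => //.
  have -> : (d ^ n.+2 - 1 = d - 1 + (d ^ n.+1 - 1) * d)%N.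
    by rewrite (expnS d n.+1); nia.
  apply: weighsM => //; first exact: weighs_d.
  apply: weighsX => //; rewrite s_sigma_tau; apply: weighsD => //.
  by apply: weighsW tw; lia.
have dX := weighs_expr_congr d d1_gt0 Tw IHt.
have := weighsM d1_gt0 tw (step_leading_tau IHs tw).
have <- : ((d ^ n.+2).+1 = d ^ n.+1 + ((d - 1) * d ^ n.+1 + 1))%N.
  by rewrite (expnS d n.+1); nia.
rewrite mulrDr -tau_S -exprS prednK // => step_w.
rewrite -expnSr in dX.
have := weighsB step_w dX; congr weighs.
rewrite exprMn -!exprM -expnSr.
have -> : (-1) ^+ (n.+1 * d) = (-1) ^+ n.+1 :> {poly int}.
  by rewrite -signr_odd oddM d_odd andbT signr_odd.
by rewrite [(-1) ^+ n.+2]exprS; ring.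
Qed.

(** The sign of the leading part of [tau] disappears in [tau^(d-1)], as [d - 1] is even. *)
Lemma step_leading n :
  weighs d (d - 1) 1 ((d - 1) * d ^ n.+1).+1
    (step n + (d%:R * 'X) ^+ ((d - 1) * d ^ n)).
Proof.
have [sw IHt] := tau_leading n.
have Tw := weighs_sign_dX n.+1 (d ^ n); rewrite -expnS in Tw.
have tw : weighs d (d - 1) 1 (d ^ n.+1) (tau d n.+1).
  exact: weighs_congr Tw IHt.
have dX := weighs_expr_congr d.-1 d1_gt0 Tw IHt.
have := step_leading_tau sw tw; rewrite addn1 => step_w.
have dE : (d ^ n.+1 * d.-1 = (d - 1) * d ^ n.+1)%N by rewrite mulnC subn1.
rewrite dE in dX; have := weighsB step_w dX; congr weighs.
rewrite exprMn -!exprM [(d ^ n * _)%N]mulnC -subn1.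
have -> : (-1) ^+ (n.+1 * (d - 1)) = 1 :> {poly int}.
  by rewrite -signr_odd oddM oddB // d_odd andbF.
ring.
Qed.

Let coef_dX N i : ((d%:R * 'X) ^+ N : {poly int})`_i = (d%:Z ^+ N) *+ (i == N).
Proof.
rewrite exprMn -natrX mulr_natl coefMn coefXn.
by case: eqP => _; rewrite ?mul0rn // !mulr1n natrX natz.
Qed.

Lemma step_coef_last n :
  exactly d ((d - 1) * d ^ n) (step n)`_((d - 1) * d ^ n).
Proof.
set E := ((d - 1) * d ^ n)%N.
have [k kE ck] := step_leading n E.
rewrite -(addrK ((d%:R * 'X) ^+ E) (step n)) coefB addrC coef_dX eqxx.
apply: exactlyD.
  rewrite exactlyN; apply/exactlyP => //; exists 1; last by rewrite mul1r.
  by rewrite dvdzE dvdn1 neq_ltn prime_gt1 ?orbT.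
apply: dvdz_trans kE; apply: dvdz_exp2l.
move: ck; rewrite expnS /E; set x := (d ^ n)%N; nia.
Qed.

(** * Values at [b = 0] and the coefficient of [b] in [step] *)

Lemma D_mul n : ((d - 1) * D_ d n = d ^ n - 1)%N.
Proof.
elim: n => [|n IH]; first by rewrite /D_ expn0 subnn div0n muln0.
by have : (0 < d ^ n)%N; rewrite ?expn_gt0 ?d_gt0 // D_S ?mulnDr ?IH ?expnS; nia.
Qed.

Lemma D_rec n : D_ d n.+1 = (1 + D_ d n * d)%N.
Proof.
have := D_mul n; have : (0 < d ^ n)%N by rewrite expn_gt0 d_gt0.
by rewrite D_S; nia.
Qed.

Lemma D_1 : D_ d 1 = 1%N.
Proof. by rewrite D_rec /D_ expn0 subnn div0n. Qed.

Lemma diff_quotient_mid_low (x y : {poly int}) : exists z,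
  diff_quotient_mid d x y = x ^+ (d - 2) *+ 'C(d, 2) + y * z.
Proof.
rewrite /diff_quotient_mid.
have [e eE] : exists e, (d - 2 = e.+1)%N by exists (d - 3)%N; lia.
rewrite eE big_ord_recl /= expr0 mul1r eE.
exists (\sum_(k < e) y ^+ k * x ^+ (d - k.+3) *+ 'C(d, k.+3)).
rewrite mulr_sumr; congr (_ + _); apply: eq_bigr => k _.
by rewrite /bump leq0n add1n mulrnAr mulrA -exprS.
Qed.

Lemma step_X n t : tau d n.+1 = 'X * t -> exists2 g, step n = 'X * g &
  g.[0] = - (sigma d n.+1).[0] ^+ (d - 1) *+ d *+ (d - 1)
          - t.[0] * (sigma d n.+1).[0] ^+ (d - 2) *+ 'C(d, 2).
Proof.
move=> tE; have [z zE] := diff_quotient_mid_low (sigma d n.+1) (tau d n.+1).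
exists (- (sigma d n.+1 ^+ (d - 1) *+ d *+ (d - 1))
        - ('X * d%:R + 1) * (t * diff_quotient_mid d (sigma d n.+1) (tau d n.+1)
                             + t * tau d n.+1 ^+ (d - 2))).
  rewrite stepE; set M := diff_quotient_mid _ _ _.
  have -> : tau d n.+1 ^+ d.-1 = 'X * t * tau d n.+1 ^+ (d - 2).
    by rewrite -tE -exprS; congr (_ ^+ _); lia.
  have -> : tau d n.+1 * M = 'X * t * M by rewrite -tE.
  by rewrite -subn1 -!mulrnAr; ring.
(* The exponent [d - 2] is positive, so [tau^(d-2)] vanishes at [b = 0]. *)
have dE : (d - 2 = (d - 3).+1)%N by lia.
rewrite zE tE {2}dE exprS.
rewrite -polyC1.
rewrite !(hornerD, hornerN, hornerM, hornerMn, hornerX, hornerC, horner_exp).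
by rewrite !mul0r !mulr0 add0r mul1r !addr0 mulrnAr mul1r !mulNrn.
Qed.

Lemma tau_X n : exists2 t, tau d n.+1 = 'X * t & t.[0] = - d%:Z *+ (n == 0%N).
Proof.
elim: n => [|n [t tE _]].
  exists (- d%:R); first by rewrite tau1 mulrN.
  by rewrite hornerN -polyC_natr hornerC mulr1n natz.
have [g gE _] := step_X tE; exists (t * ('X * g)); first by rewrite tau_S tE gE -mulrA.
by rewrite !hornerM hornerX mul0r mulr0.
Qed.

(** As [tau] vanishes at [b = 0], there [s_(n+1) = d s_n^d], whose exponents of [d] follow
    [D_rec]. *)
Lemma s_horner0 n : (s_ d n).[0] = d%:Z ^+ D_ d n.
Proof.
elim: n => [|n IH]; first by rewrite /s_ /= -polyC1 hornerC /D_ expn0 subnn div0n.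
have [t tE _] := tau_X n.
rewrite s_sigma_tau tE sigmaS hornerD !hornerM horner_exp IH hornerX mul0r addr0.
rewrite hornerD hornerX -polyC1 hornerMn hornerC add0r mul1r natz.
by rewrite D_rec exprD expr1 -exprM.
Qed.

Lemma sigma_horner0 n : (sigma d n.+1).[0] = d%:Z ^+ D_ d n.+1.
Proof.
have [t tE _] := tau_X n.
by rewrite -s_horner0 s_sigma_tau hornerD tE (hornerM 'X) hornerX mul0r addr0.
Qed.

Let ndvd_lt (u : nat) : (0 < u < d)%N -> ~~ (d%:Z %| u%:Z)%Z.
Proof. by move=> /andP[u0 ud]; rewrite dvdzE /= gtnNdvd. Qed.

Lemma step_coef01 n : (step n)`_0 = 0 /\ exactly d (d ^ n.+1) (step n)`_1.
Proof.
have [t tE t0] := tau_X n; have [g -> g0] := step_X tE.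
rewrite !coefXM /=; split=> //.
rewrite -horner_coef0 g0 t0 sigma_horner0 -exprM mulnC D_mul.
have dq : (0 < d ^ n.+1)%N by rewrite expn_gt0 d_gt0.
have mulrnE (x : int) N : x *+ N = x * N%:Z by rewrite -mulr_natr natz.
have dqE : d%:Z ^+ (d ^ n.+1) = d%:Z ^+ (d ^ n.+1 - 1) * d%:Z.
  by rewrite -exprSr subn1 prednK.
apply/exactlyP => //.
case: n {tE t0 g0} t dq dqE => [|n] t dq dqE.
  (* For [n = 0] both terms have the same valuation: with [d = 2q + 1] they are [- 2q d^d] and
     [q d^d], and [d] does not divide [q]. *)
  have [q dE] : exists q, (d = q.*2.+1)%N.
    by exists d./2; rewrite -[LHS]odd_double_half d_odd.
  exists (- q%:Z); first by rewrite rpredN; apply: ndvd_lt; lia.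
  have CE : 'C(d, 2) = (d * q)%N by rewrite bin2 {2}dE /= -doubleMr doubleK.
  rewrite dqE expn1 eqxx mulr1n CE.
  rewrite D_1 expr1; have -> : (d - 1 = (d - 2).+1)%N by lia.
  rewrite !mulrnE exprS PoszM.
  have -> : Posz (d - 2).+1 = 2 * q%:Z by lia.
  by ring.
(* For larger indices [b^2] divides [tau], so only the first term remains. *)
exists (- (d - 1)%:Z); first by rewrite rpredN; apply: ndvd_lt; lia.
rewrite mulr0n mul0r mul0rn subr0 !mulrnE dqE; ring.
Qed.

Lemma tau_Xn n : exists g, tau d n.+1 = 'X^(n.+1) * g.
Proof.
elim: n => [|n [g gE]]; first by have [t tE _] := tau_X 0; exists t.
have [t /step_X[g' g'E _] _] := tau_X n.
by exists (g * g'); rewrite tau_S gE g'E mulrACA -exprSr.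
Qed.

(** * The edge of [step n] from [(1, d ^ n.+1)] to [(E, E)], where [E = (d - 1) * d ^ n] *)

Let step_edge_end n :
  (((d - 1) * d ^ n - 1) * ((d - 1) * d ^ n) + d ^ n * ((d - 1) * d ^ n) =
   ((d - 1) * d ^ n - 1) * d ^ n.+1 + d ^ n)%N.
Proof.
have : (0 < d ^ n)%N by rewrite expn_gt0 d_gt0.
by rewrite expnS; move: (d ^ n)%N => x x0; nia.
Qed.

(** By [step_leading], every monomial of degree other than [E] lies on or above the line of slope
    [- 1 / (d - 1)] through [(1, d ^ n.+1)]. The edge is steeper, hence below that line for [i > 0];
    the monomial of degree [E] is its right end. *)
Lemma step_edge n i : (0 < i)%N ->
  exists k, [/\ (d%:Z ^+ k %| (step n)`_i)%Z, ((d - 1) * d ^ n <= k)%N &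
    (((d - 1) * d ^ n - 1) * d ^ n.+1 + d ^ n <=
     ((d - 1) * d ^ n - 1) * k + d ^ n * i)%N].
Proof.
move=> i0; set E := ((d - 1) * d ^ n)%N; set x := (d ^ n)%N.
have x0 : (0 < x)%N by rewrite expn_gt0 d_gt0.
have EE : E = ((d - 1) * x)%N by [].
have qE : (d ^ n.+1 = E + x)%N by rewrite expnS /E -/x; nia.
rewrite qE.
case: (eqVneq i E) => [->|iE].
  exists E; split=> //; first by case/andP: (step_coef_last n).
  have : (0 < E)%N by rewrite EE; nia.
  nia.
have [k1 ki1 ck1] := step_leading n i.
have [k2 ki2] := step_weighs_content n i.
rewrite mul1n mul0n addn0 => ck2.
move: ki1; rewrite coefD coef_dX (negPf iE) mulr0n addr0 => ki1.
(* The leading form and the content give two powers of [d]; the larger one satisfies both bounds. *)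
exists (maxn k1 k2); split.
- by rewrite /maxn; case: ifP.
- by rewrite leq_max ck2 orbT.
move: ck1; rewrite qE mul1n => ck1.
apply: (@leq_trans ((E - 1) * k1 + x * i)); last first.
  by rewrite leq_add2r leq_mul2l leq_maxl orbT.
case: (leqP (E + x) k1) => [ge|lt]; first by nia.
have [t tE] : exists t, (E + x = k1 + t)%N by exists (E + x - k1)%N; lia.
rewrite tE in ck1 *.
have ti : ((d - 1) * t <= i - 1)%N by nia.
have xti : (E * t <= x * (i - 1))%N by rewrite EE -mulnA mulnCA leq_mul2l ti orbT.
have Et : ((E - 1) * t <= E * t)%N by rewrite leq_mul2r leq_subr orbT.
have xi : (x * i = x * (i - 1) + x)%N by rewrite -mulnSr subn1 prednK.
by rewrite mulnDr xi; lia.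
Qed.

Let edge_gt0 n : (0 < (d - 1) * d ^ n - 1)%N.
Proof. by have : (0 < d ^ n)%N; rewrite ?expn_gt0 ?d_gt0 //; nia. Qed.

Lemma step_left w h n : (0 < w)%N -> (d ^ n * w <= h * ((d - 1) * d ^ n - 1))%N ->
  weighs d w h (w * d ^ n.+1 + h * 1) (step n).
Proof.
move=> w0 wh i; case: (posnP i) => [->|i0].
  by rewrite (step_coef01 n).1; apply: mono_weighs0.
have [k [ki _ ck]] := step_edge n i0; exists k => //.
by rewrite muln1; apply: left_vertex_le wh; rewrite ?edge_gt0.
Qed.

Lemma step_left_dominates w h n : (0 < w)%N ->
  (d ^ n * w < h * ((d - 1) * d ^ n - 1))%N ->
  dominates d w h 1 (d ^ n.+1) (step n).
Proof.
move=> w0 wh; split=> [|i i1]; first exact: (step_coef01 n).2.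
case: (posnP i) => [->|i0]; first by rewrite (step_coef01 n).1; apply: mono_weighs0.
have [k [ki _ ck]] := step_edge n i0; exists k => //.
by rewrite muln1; apply: left_vertex_lt wh; rewrite ?edge_gt0 //; lia.
Qed.

Lemma step_right w h n : (0 < w)%N -> (h * ((d - 1) * d ^ n - 1) <= d ^ n * w)%N ->
  weighs d w h (w * ((d - 1) * d ^ n) + h * ((d - 1) * d ^ n)) (step n).
Proof.
move=> w0 wh i; case: (posnP i) => [->|i0].
  by rewrite (step_coef01 n).1; apply: mono_weighs0.
have [k [ki Ek ck]] := step_edge n i0; exists k => //.
apply: right_vertex_le wh; rewrite ?edge_gt0 //.
by apply: leq_trans ck; rewrite step_edge_end.
Qed.

Lemma step_right_dominates w h n : (0 < w)%N -> (0 < h)%N ->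
  (h * ((d - 1) * d ^ n - 1) < d ^ n * w)%N ->
  dominates d w h ((d - 1) * d ^ n) ((d - 1) * d ^ n) (step n).
Proof.
move=> w0 h0 wh; split=> [|i iE]; first exact: step_coef_last.
case: (posnP i) => [->|i0]; first by rewrite (step_coef01 n).1; apply: mono_weighs0.
have [k [ki Ek ck]] := step_edge n i0; exists k => //.
apply: right_vertex_lt wh; rewrite ?edge_gt0 //.
by apply: leq_trans ck; rewrite step_edge_end.
Qed.

(** * The polygon of [tau] as a product of [tau d 1] and the [step j] *)

Let tau1_dominates w h : (0 < w)%N -> dominates d w h 1 1 (tau d 1).
Proof.
move=> w0; have tE : tau d 1 = - ((d%:R * 'X) ^+ 1) by rewrite tau1 mulrC.
rewrite tE; split=> [|i i1]; rewrite coefN coef_dX.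
  rewrite eqxx exactlyN; apply/exactlyP => //; exists 1; last by rewrite mul1r.
  by apply: ndvd_lt; rewrite prime_gt1.
by rewrite (negPf i1) mulr0n oppr0; apply: mono_weighs0.
Qed.

Let expn_split n : (d ^ n.+1 = d ^ n + (d - 1) * d ^ n)%N.
Proof. by rewrite expnS; nia. Qed.

(** For a slope no steeper than the edges of the [step j] with [j < i], each of them is lightest at
    its right end, and [1] plus the sum of the [(d - 1) * d ^ j] is [d ^ i]. *)
Lemma tau_right w h i : (0 < w)%N ->
  (forall j, (j < i)%N -> (h * ((d - 1) * d ^ j - 1) <= d ^ j * w)%N) ->
  weighs d w h (w * d ^ i + h * d ^ i) (tau d i.+1).
Proof.
move=> w0; elim: i => [|i IH] hyp; first exact: dominates_weighs (tau1_dominates _ _).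
rewrite tau_S expn_split !mulnDr addnACA; apply: weighsM => //.
  by apply: IH => j ji; apply: hyp; exact: ltnW.
by apply: step_right => //; apply: hyp.
Qed.

Lemma tau_right_dominates w h i : (0 < w)%N -> (0 < h)%N ->
  (forall j, (j < i)%N -> (h * ((d - 1) * d ^ j - 1) < d ^ j * w)%N) ->
  dominates d w h (d ^ i) (d ^ i) (tau d i.+1).
Proof.
move=> w0 h0; elim: i => [|i IH] hyp; first exact: tau1_dominates.
rewrite tau_S expn_split; apply: dominatesM => //.
  by apply: IH => j ji; apply: hyp; exact: ltnW.
by apply: step_right_dominates => //; apply: hyp.
Qed.

Let height_S i e : (d ^ i * D_ d e.+2 = d ^ i * D_ d e.+1 + d ^ (i + e).+1)%N.
Proof. by rewrite (D_S e.+1 (ltnW d_ge3)) mulnDr -expnD addnS. Qed.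

(** The [e] further factors are lightest at their left ends [(1, d ^ j.+1)]; the heights [d ^ i],
    ..., [d ^ (i + e)] add up to [d ^ i * D_ d e.+1]. *)
Lemma tau_left w h i e : (0 < w)%N ->
  (forall j, (i <= j)%N -> (d ^ j * w <= h * ((d - 1) * d ^ j - 1))%N) ->
  weighs d w h (w * d ^ i + h * d ^ i) (tau d i.+1) ->
  weighs d w h (w * (d ^ i * D_ d e.+1) + h * (d ^ i + e)) (tau d (i + e).+1).
Proof.
move=> w0 hyp base; elim: e => [|e IH].
  by rewrite D_1 !addn0 muln1.
rewrite (addnS i) tau_S height_S.
have -> : (w * (d ^ i * D_ d e.+1 + d ^ (i + e).+1) + h * (d ^ i + e.+1) =
  w * (d ^ i * D_ d e.+1) + h * (d ^ i + e) + (w * d ^ (i + e).+1 + h * 1))%N by nia.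
by apply: weighsM => //; apply: step_left => //; apply: hyp; rewrite leq_addr.
Qed.

Lemma tau_left_dominates w h i e : (0 < w)%N ->
  (forall j, (i <= j)%N -> (d ^ j * w < h * ((d - 1) * d ^ j - 1))%N) ->
  dominates d w h (d ^ i) (d ^ i) (tau d i.+1) ->
  dominates d w h (d ^ i + e) (d ^ i * D_ d e.+1) (tau d (i + e).+1).
Proof.
move=> w0 hyp base; elim: e => [|e IH].
  by rewrite D_1 !addn0 muln1.
rewrite (addnS i) tau_S height_S.
have -> : (d ^ i + e.+1 = d ^ i + e + 1)%N by lia.
apply: dominatesM => //.
by apply: step_left_dominates => //; apply: hyp; rewrite leq_addr.
Qed.

Let expn_lt i j : (i < j)%N -> (3 * d ^ i <= d ^ j)%N.
Proof.
move=> ij; apply: leq_trans (_ : d ^ i.+1 <= _)%N.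
  by rewrite expnS leq_mul2r d_ge3 orbT.
by rewrite leq_exp2l //; lia.
Qed.

Let pow_gt0 i : (0 < d ^ i)%N. Proof. by rewrite expn_gt0 d_gt0. Qed.

(* The slope [- h / w] chosen here lies strictly between those of the two edges
   that meet at the vertex number [i]. *)
Lemma tau_vertex i e : exactly d (d ^ i * D_ d e.+1) (tau d (i + e).+1)`_(d ^ i + e).
Proof.
(* With [E = (d - 1) * d ^ i], edges [i - 1] and [i] have slopes [- d ^ i / (E - d)] and
   [- d ^ i / (E - 1)]; the choice is [- d ^ i / (E - 3/2)], and [1 < 3/2 < d]. *)
pose w := (2 * ((d - 1) * d ^ i) - 3)%N; pose h := (2 * d ^ i)%N.
have w0 : (0 < w)%N by rewrite /w; have := pow_gt0 i; nia.
have h0 : (0 < h)%N by rewrite /h; have := pow_gt0 i; nia.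
have wE : (w + 3 = 2 * ((d - 1) * d ^ i))%N by rewrite /w in w0 *; lia.
suff [] : dominates d w h (d ^ i + e) (d ^ i * D_ d e.+1) (tau d (i + e).+1) by [].
apply: tau_left_dominates => // [j ij|].
  have xy : (d ^ i <= d ^ j)%N by rewrite leq_exp2l //; lia.
  have := pow_gt0 i; have := edge_gt0 j; rewrite /h.
  move: (d ^ i)%N (d ^ j)%N xy wE => x y xy wE ey x0; nia.
apply: tau_right_dominates => // j /expn_lt.
have := pow_gt0 j; have := edge_gt0 j; rewrite /h.
move: (d ^ i)%N (d ^ j)%N wE => x y wE ey y0 xy; nia.
Qed.

(** Along the slope of edge [i], both ends of [step i] weigh the same, so the factor may be counted
    at its left end with the later ones. *)
Lemma tau_edge i e :
  weighs d ((d - 1) * d ^ i - 1) (d ^ i)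
    (((d - 1) * d ^ i - 1) * (d ^ i * D_ d e.+1) + d ^ i * (d ^ i + e))
    (tau d (i + e).+1).
Proof.
have slope_mono j k : (j <= k)%N ->
    (d ^ k * ((d - 1) * d ^ j - 1) <= d ^ j * ((d - 1) * d ^ k - 1))%N.
  move=> jk; have xy : (d ^ j <= d ^ k)%N by rewrite leq_exp2l //; lia.
  rewrite !mulnBr !muln1 [(d ^ j * _)%N]mulnCA [(d ^ k * (_ * _))%N]mulnCA.
  by rewrite [(d ^ j * d ^ k)%N]mulnC leq_sub2l.
have w0 := edge_gt0 i.
apply: tau_left => // [j ij|]; first exact: slope_mono.
by apply: tau_right => // j /ltnW/slope_mono.
Qed.

Lemma tau_principal_newton n :
  principal_newton_is d (ZtoQ (tau d n.+1))
    [seq ((d ^ i + (n - i))%N, Posz (d ^ i * D_ d (n.+1 - i))%N)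
    | i <- iota 0 n.+1].
Proof.
(* Edge [i] of [tau] has the width and the drop of the edge of [step i]. *)
have nS i : (i < n)%N -> (d ^ i.+1 + (n - i.+1) =
    d ^ i + (n - i) + ((d - 1) * d ^ i - 1))%N.
  by move=> i_n; have := edge_gt0 i; rewrite expn_split; lia.
have vS i : (i < n)%N -> (d ^ i * D_ d (n.+1 - i) =
    d ^ i.+1 * D_ d (n.+1 - i.+1) + d ^ i)%N.
  by move=> i_n; rewrite subSn ?(ltnW i_n) // D_rec subSS mulnDr muln1 expnS; nia.
apply: (@principal_newton_is_weighs d d_prime (tau d n.+1) n
  (fun i => d ^ i + (n - i))%N (fun i => d ^ i * D_ d (n.+1 - i))%N)
  => [i i_n|i i_n|i i_n|i i_n|j|i i_n|].
- by rewrite nS // -[X in (X < _)%N]addn0 ltn_add2l edge_gt0.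
- by rewrite (vS i) // -[X in (X < _)%N]addn0 ltn_add2l pow_gt0.
- rewrite (nS _ i_n) (nS _ (ltnW i_n)) !addKn.
  rewrite (vS _ (ltnW i_n)) (vS _ i_n) !addKn.
  have := edge_gt0 i; have := pow_gt0 i; rewrite expnS.
  move: (d ^ i)%N => x x0 e0; rewrite !mulnBr !muln1.
  have -> : (x * ((d - 1) * (d * x)) = d * x * ((d - 1) * x))%N by nia.
  have : (d * x * 2 <= d * x * ((d - 1) * x))%N by rewrite leq_mul2l; lia.
  have : (3 * x <= d * x)%N by rewrite leq_mul2r d_ge3 orbT.
  by lia.
- by have := tau_vertex i (n - i); rewrite subnKC // subSn.
- rewrite expn0 subn0 => jn; have [g ->] := tau_Xn n.
  by rewrite coefXnM; case: ifP => //; lia.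
- rewrite nS // (vS i) // !addKn -(vS i) //.
  by have := tau_edge i (n - i); rewrite subnKC ?(ltnW i_n) // subSn // ltnW.
- have [_] := sigma_weighs_content n; congr weighs.
  by rewrite subSnn D_1 muln1.
Qed.

(** * The polygon of [G] *)

Lemma step_div n : exists2 G, step n = 'X * d%:R * G &
  forall i, (step n)`_i.+1 = d%:Z * G`_i.
Proof.
(* The divisions are exact because the content exponent [(d - 1) * d ^ n] is positive. *)
pose G := \poly_(i < size (step n)) ((step n)`_i.+1 %/ d%:Z)%Z.
have GE i : (step n)`_i.+1 = d%:Z * G`_i.
  rewrite coef_poly; case: ltnP => [_|si]; last first.
    by rewrite mulr0 nth_default // leqW.
  have [k ki] := step_weighs_content n i.+1.
  rewrite mul1n mul0n addn0 mulrC => ck; rewrite divzK //.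
  apply: dvdz_trans ki; rewrite -[X in (X %| _)%Z]expr1; apply: dvdz_exp2l.
  by apply: leq_trans ck; have := edge_gt0 n; lia.
exists G => //; apply/polyP => i; rewrite -mulrA coefXM.
case: i => [|i] /=; first exact: (step_coef01 n).1.
by rewrite mulr_natl coefMn GE -mulr_natl natz.
Qed.

(** The inner numerator is [tau] times [diff_quotient], and [tau] cancels in the fraction field: it
    has a coefficient of finite valuation, so it is nonzero. *)
Lemma calG_step n (G : {poly int}) : step n = 'X * d%:R * G -> tofrac G = calG d n.+1.
Proof.
move=> GE.
have t0 : tau d n.+1 != 0.
  have /andP[_] := tau_vertex n 0; apply: contraNneq; rewrite addn0 => ->.
  by rewrite coef0 dvdz0.
have dX0 : 'X * d%:R != 0 :> {poly int}.
  rewrite mulf_neq0 ?polyX_eq0 // -polyC_natr polyC_eq0 natz.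
  by rewrite eqz_nat -lt0n.
rewrite /calG subn1 /= -sigma_expr -sigmaS -/(tau d n.+1) {1}s_sigma_tau.
rewrite -diff_quotientE [tofrac (tau _ _ * _)]tofracM.
rewrite [tofrac (tau _ _) * _ / _]mulrC mulKf ?tofrac_eq0 // -tofracM -tofracB.
have -> : sigma d n.+1 ^+ d.-1 * (('X + 1) * d%:R) -
  ('X * d%:R + 1) * diff_quotient d (sigma d n.+1) (tau d n.+1) = step n.
  by rewrite /step [X in X - _]mulrC.
by rewrite GE (tofracM _ G) mulKf // tofrac_eq0.
Qed.

(** Dividing by [b d] moves the polygon of [step n] one unit left and one unit down. *)
Lemma calG_principal_newton n (G : {poly int}) :
  (forall i, (step n)`_i.+1 = d%:Z * G`_i) ->
  principal_newton_is d (ZtoQ G)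
    [:: (0%N, Posz (d ^ n.+1 - 1)%N);
        ((d ^ n.+1 - d ^ n - 1)%N, Posz (d ^ n.+1 - d ^ n - 1)%N)].
Proof.
move=> GE.
have dvdG k i : (d%:Z ^+ k.+1 %| (step n)`_i.+1)%Z = (d%:Z ^+ k %| G`_i)%Z.
  by rewrite GE exprS dvdz_mul2l // eqz_nat -lt0n.
have exG k i : exactly d k.+1 (step n)`_i.+1 -> exactly d k G`_i.
  by rewrite /exactly !dvdG.
have weG i : exists k, [/\ (d%:Z ^+ k %| G`_i)%Z, ((d - 1) * d ^ n <= k.+1)%N &
    (((d - 1) * d ^ n - 1) * d ^ n.+1 + d ^ n <=
     ((d - 1) * d ^ n - 1) * k.+1 + d ^ n * i.+1)%N].
  have [[|k] [ki Ek ck]] := step_edge n (ltn0Sn i).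
    by have := edge_gt0 n; lia.
  by exists k; rewrite dvdG in ki.
have EE : (d ^ n.+1 - d ^ n - 1 = (d - 1) * d ^ n - 1)%N.
  by rewrite expn_split addKn.
have q1 := expn_split n; have x0 := pow_gt0 n; have e0 := edge_gt0 n.
apply: (@principal_newton_is_weighs d d_prime G 1
  (fun i => if i is 0 then 0 else d ^ n.+1 - d ^ n - 1)%N
  (fun i => if i is 0 then d ^ n.+1 - 1 else d ^ n.+1 - d ^ n - 1)%N)
  => [[|i] //= _|[|i] //= _|i //|[|[|i]] //= _|j //|[|i] //= _|/=].
- by rewrite EE.
- by lia.
- apply: exG; rewrite subn1 prednK ?pow_gt0 //; exact: (step_coef01 n).2.
- apply: exG; rewrite EE subn1 prednK; first exact: step_coef_last.
  by lia.
- move=> i; have [k [ki Ek ck]] := weG i; exists k => //.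
  rewrite subn0 EE.
  have -> : (d ^ n.+1 - 1 - ((d - 1) * d ^ n - 1) = d ^ n)%N by lia.
  move: ck; rewrite muln0 addn0 !mulnS mulnBr muln1; lia.
- move=> i; have [k [ki Ek ck]] := weG i; exists k => //.
  by rewrite EE mul1n mul0n addn0; lia.
Qed.

End Recurrence.

Theorem theorem4p4 (d : nat) (d_prime : prime d) (d_ge3 : (3 <= d)%N)
    (m : nat) (m_ge1 : (1 <= m)%N) :
  (exists G : {poly int}, tofrac G = calG d m /\
     principal_newton_is d (ZtoQ G)
       [:: (0%N, Posz (d ^ m - 1)%N);
           ((d ^ m - d ^ (m - 1) - 1)%N, Posz (d ^ m - d ^ (m - 1) - 1)%N)])
  /\
  principal_newton_is d (ZtoQ (tau d m))
    [seq ((d ^ i + (m - 1 - i))%N, Posz (d ^ i * D_ d (m - i))%N)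
    | i <- iota 0 m].
Proof.
case: m m_ge1 => // n _; rewrite (subn1 n.+1) succnK; split.
  have [G GE coefE] := step_div d_prime d_ge3 n.
  exists G; split; first exact: calG_step.
  exact: calG_principal_newton.
exact: tau_principal_newton.
Qed.
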